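(* Let $\mathcal P$ be a hereditary graph class and let $\Gamma$ be a graph limit. Then $\Gamma\in\overline{\mathcal P}$ if and only if, for every $n\ge1$, $G(n,\Gamma)\in\mathcal P$ almost surely.
   Context: All graphs are finite and simple (with at least one vertex). $\mathcal U$ is the set of all unlabelled graphs (isomorphism classes of graphs), and $|G|$ is the number of vertices of $G$. A graph class is a subset of $\mathcal U$; it is hereditary if every induced subgraph of a graph in the class is also in the class. A labelled graph is said to belong to a graph class if its isomorphism class does. For graphs $F,G$, $t(F,G)$ is the probability that a uniformly random map $V(F)\to V(G)$ is a graph homomorphism, and $t_{\mathrm{ind}}(F,G)$ is, when $|F|\le|G|$, the probability that a uniformly random injective map $V(F)\to V(G)$ is an isomorphism onto an induced subgraph of $G$ (and $0$ when $|F|>|G|$). The space $\overline{\mathcal U}$: embed $\mathcal U$ in $[0,1]^{\mathcal U}\times[0,1]$ by $G\mapsto((t(F,G))_{F\in\mathcal U},1/|G|)$ and let $\overline{\mathcal U}$ be the closure of the image; it is a compact metrizable space in which $\mathcal U$ is a countable, discrete, dense, open subset. The elements of $\widehat{\mathcal U}:=\overline{\mathcal U}\setminus\mathcal U$ are called graph limits. For each fixed graph $F$, $t(F,\cdot)$ and $t_{\mathrm{ind}}(F,\cdot)$ extend by continuity to $\overline{\mathcal U}$. For a graph class $\mathcal P$, $\overline{\mathcal P}$ is its closure in $\overline{\mathcal U}$. For a graph limit $\Gamma$ and $n\ge1$, $G(n,\Gamma)$ is the random graph with vertex set $[n]=\{1,\dots,n\}$ whose distribution is given by $\mathbb P(G(n,\Gamma)=F)=t_{\mathrm{ind}}(F,\Gamma)$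 for every (labelled) graph $F$ on $[n]$. *)

(* Defs.v *)
From HB Require Import structures.
From mathcomp Require Import all_boot all_order all_algebra generic_quotient.
From mathcomp Require Import all_classical all_reals all_analysis.
From mathcomp Require Import lra.

Set Implicit Arguments.
Unset Strict Implicit.
Unset Printing Implicit Defensive.

Import Order.TTheory GRing.Theory Num.Theory.
Import numFieldNormedType.Exports.

Local Open Scope quotient_scope.
Local Open Scope classical_set_scope.
Local Open Scope ring_scope.

Record sgraph (n : nat) := SGraph {
  adj : {ffun 'I_n * 'I_n -> bool} ;
  adjP : [forall x, forall y, adj (x, y) == adj (y, x)] &&
         [forall x, ~~ adj (x, x)] }.

HB.instance Definition _ n := [isSub for @adj n].
HB.instance Definition _ n := [Finite of sgraph n by <:].

Definition edge n (G : sgraph n) : rel 'I_n := fun x y => adj G (x, y).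
Coercion edge : sgraph >-> rel.

Definition homb m n (F : sgraph m) (G : sgraph n) (f : {ffun 'I_m -> 'I_n}) :=
  [forall x, forall y, F x y ==> G (f x) (f y)].

(* f is an isomorphism of F onto an induced subgraph of G. *)
Definition embb m n (F : sgraph m) (G : sgraph n) (f : {ffun 'I_m -> 'I_n}) :=
  injectiveb f && [forall x, forall y, F x y == G (f x) (f y)].

(* Finite graphs with at least one vertex, on the vertex sets 'I_1, 'I_2, etc. *)
Definition fgraph := {n : nat & sgraph n.+1}.

Definition isob (F G : fgraph) : bool :=
  [exists f : {ffun 'I_(tag F).+1 -> 'I_(tag G).+1},
     embb (tagged F) (tagged G) f && [forall y, y \in codom f]].

Lemma isoP (F G : fgraph) :
  reflect (exists f : 'I_(tag F).+1 -> 'I_(tag G).+1, bijective f /\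
             forall x y, tagged F x y = tagged G (f x) (f y))
          (isob F G).
Proof.
apply: (iffP existsP) => [[f /andP[/andP[/injectiveP finj /forallP fe]]]|].
  move=> /forallP fs; exists f; split; last first.
    by move=> x y; apply/eqP; move/forallP: (fe x).
  by exists (fun y => iinv (fs y)) => x; rewrite ?f_iinv//; apply: finj; rewrite f_iinv.
move=> [f [fbij fe]]; exists (finfun f); apply/andP; split.
  apply/andP; split.
    by apply/injectiveP => x y; rewrite !ffunE; exact: (bij_inj fbij).
  by apply/forallP => x; apply/forallP => y; rewrite !ffunE fe.
case: fbij => g fK gK.
by apply/forallP => y; apply/codomP; exists (g y); rewrite ffunE gK.
Qed.

Lemma isob_refl : reflexive isob.
Proof. by move=> F; apply/isoP; exists id; split => //; exists id. Qed.

Lemma isob_sym : symmetric isob.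
Proof.
have h F G : isob F G -> isob G F.
  move=> /isoP[f [[g fK gK] fe]]; apply/isoP; exists g.
  by split=> [|x y]; [exists f|rewrite fe !gK].
by move=> F G; apply/idP/idP; exact: h.
Qed.

Lemma isob_trans : transitive isob.
Proof.
move=> G F H /isoP[f [fbij fe]] /isoP[g [gbij ge]]; apply/isoP; exists (g \o f).
by split=> [|x y]; [exact: bij_comp|rewrite fe ge].
Qed.

Canonical isob_equiv := EquivRel isob isob_refl isob_sym isob_trans.

(* Unlabelled graphs: isomorphism classes of nonempty finite graphs. *)
Definition ugraph := {eq_quot isob}.
HB.instance Definition _ := EqQuotient.on ugraph.
HB.instance Definition _ := Choice.on ugraph.

Definition unlabel n (G : sgraph n.+1) : ugraph := \pi_ugraph (existT _ n G).

Definition uorder (G : ugraph) : nat := (tag (repr G)).+1.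
Definition ulabel (G : ugraph) : sgraph (uorder G) := tagged (repr G).

Lemma induced_subproof m n (G : sgraph n) (f : 'I_m -> 'I_n) :
  let a := [ffun p : 'I_m * 'I_m => G (f p.1) (f p.2)] in
  [forall x, forall y, a (x, y) == a (y, x)] && [forall x, ~~ a (x, x)].
Proof.
have /andP[/forallP Gsym /forallP Girr] := adjP G.
apply/andP; split; apply/forallP => x; last by rewrite ffunE; exact: Girr.
apply/forallP => y; rewrite !ffunE; exact: (forallP (Gsym (f x))).
Qed.

(* For injective f, the subgraph of G induced on the image of f, its vertices
   being labelled through f. *)
Definition induced m n (G : sgraph n) (f : 'I_m -> 'I_n) : sgraph m :=
  SGraph (induced_subproof G f).

Definition graph_class := set ugraph.

Definition hereditary (P : graph_class) :=
  forall n (G : sgraph n.+1), P (unlabel G) ->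
  forall m (f : 'I_m.+1 -> 'I_n.+1), injective f -> P (unlabel (induced G f)).

Section densities.
Variable R : realType.

Definition hom_density m n (F : sgraph m) (G : sgraph n) : R :=
  #|[pred f | homb F G f]|%:R / #|{ffun 'I_m -> 'I_n}|%:R.

Definition ind_density m n (F : sgraph m) (G : sgraph n) : R :=
  if (m <= n)%N then
    #|[pred f | embb F G f]|%:R /
    #|[pred f : {ffun 'I_m -> 'I_n} | injectiveb f]|%:R
  else 0.

(* [ulabel] picks a labelling; the densities do not depend on the choice. *)
Definition t (F G : ugraph) : R := hom_density (ulabel F) (ulabel G).

Definition t_ind m (F : sgraph m) (G : ugraph) : R := ind_density F (ulabel G).

(* The product space R^ugraph x R. The image of [embedding] lies in the closed
   subset [0,1]^ugraph x [0,1], so closures of sets of graphs are the same in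
   both spaces. *)
Definition graph_space := ({ptws ugraph -> R} * R)%type.

Definition embedding (G : ugraph) : graph_space :=
  (fun F => t F G, (uorder G)%:R^-1).

(* As Ubar is closed, this is also the closure within Ubar. *)
Definition closure_of (P : graph_class) : set graph_space :=
  closure (embedding @` P).

Definition Ubar : set graph_space := closure_of setT.

Definition graph_limits : set graph_space := Ubar `\` range embedding.

(* The trace on the set of graphs of the neighbourhoods of a point. *)
Definition graphs_near (x : graph_space) : set_system ugraph :=
  filter_from (nbhs x) (fun V => embedding @^-1` V).

(* The value at x of the extension of t_ind F by continuity; the limit exists
   whenever x is a graph limit, see [is_cvg_t_ind] below. *)
Definition t_ind_ext m (F : sgraph m) (x : graph_space) : R :=
  lim (t_ind F @ graphs_near x).

End densities.

Arguments Ubar R : clear implicits.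
Arguments graph_limits R : clear implicits.

Section finite_counting.
Variable R : realType.
Local Notation hom_density := (hom_density R).
Local Notation ind_density := (ind_density R).

Definition subgraphb m (F F' : sgraph m) :=
  [forall x, forall y, F x y ==> F' x y].

Lemma sgraph_eqP m (F F' : sgraph m) : F =2 F' -> F = F'.
Proof.
by move=> FF'; apply: val_inj; apply/ffunP => -[x y]; exact: FF'.
Qed.

Lemma embbE m n (F : sgraph m) (G : sgraph n) (f : {ffun 'I_m -> 'I_n}) :
  embb F G f = injectiveb f && (F == induced G f).
Proof.
rewrite /embb; congr andb; apply/forallP/eqP => [FG|-> x].
  apply: sgraph_eqP => x y.
  by rewrite {2}/edge ffunE; apply/eqP; exact: (forallP (FG x)).
by apply/forallP => y; rewrite {1}/edge ffunE.
Qed.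

Lemma hombE m n (F : sgraph m) (G : sgraph n) (f : {ffun 'I_m -> 'I_n}) :
  homb F G f = subgraphb F (induced G f).
Proof.
by apply: eq_forallb => x; apply: eq_forallb => y; rewrite /edge/= ffunE.
Qed.

Lemma sum_embb m n (G : sgraph n) (Q : pred (sgraph m)) :
  (\sum_(F | Q F) #|[pred f | embb F G f]| =
   #|[pred f : {ffun 'I_m -> 'I_n} | injectiveb f && Q (induced G f)]|)%N.
Proof.
rewrite -sum1_card (partition_big (fun f => induced G (f : {ffun _ -> _})) Q)/=;
  last by move=> f /andP[].
apply: eq_bigr => F QF; rewrite -sum1_card; apply: eq_bigl => f.
rewrite !inE embbE [F == _]eq_sym.
by case: eqP => [->|]; rewrite ?andbF// QF !andbT.
Qed.

Lemma card_injectiveb m n :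
  #|[pred f : {ffun 'I_m -> 'I_n} | injectiveb f]| = (n ^_ m)%N.
Proof.
rewrite -[in RHS](card_ord m) -[X in (X ^_ _)%N](card_ord n) -card_inj_ffuns.
by apply: eq_card => f; rewrite inE.
Qed.

Definition inj_density m n (F : sgraph m) (G : sgraph n) : R :=
  \sum_(F' | subgraphb F F') ind_density F' G.

Lemma sum_ind_density m n (G : sgraph n) (Q : pred (sgraph m)) : (m <= n)%N ->
  \sum_(F | Q F) ind_density F G =
    #|[pred f : {ffun 'I_m -> 'I_n} | injectiveb f && Q (induced G f)]|%:R /
    (n ^_ m)%:R.
Proof.
move=> mn; rewrite -sum_embb natr_sum mulr_suml; apply: eq_bigr => F _.
by rewrite /ind_density mn card_injectiveb.
Qed.

Lemma ind_density_total m n (G : sgraph n) : (m <= n)%N ->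
  \sum_(F : sgraph m) ind_density F G = 1.
Proof.
move=> mn; rewrite sum_ind_density// (eq_card (B := [pred f : {ffun 'I_m -> 'I_n} | injectiveb f])).
  by rewrite card_injectiveb divff// pnatr_eq0 -lt0n ffact_gt0.
by move=> f; rewrite !inE andbT.
Qed.

Lemma inj_density_hom m n (F : sgraph m) (G : sgraph n) : (m <= n)%N ->
  `|inj_density F G - hom_density F G| <= 1 - (n ^_ m)%:R / (n ^ m)%:R.
Proof.
move=> mn; rewrite /inj_density sum_ind_density// /hom_density card_ffun !card_ord.
set a := #|_|; set h := #|_|; set b := (n ^_ m)%N; set N := (n ^ m)%N.
have ah : (a <= h)%N.
  by apply: subset_leq_card; apply/fintype.subsetP => f; rewrite !inE hombE => /andP[].
have ab : (a <= b)%N.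
  rewrite /b -card_injectiveb; apply: subset_leq_card; apply/fintype.subsetP => f.
  by rewrite !inE => /andP[].
have bN : (b <= N)%N.
  rewrite /b /N -card_injectiveb -[X in (_ <= X ^ _)%N]card_ord.
  by rewrite -[X in (_ <= _ ^ X)%N]card_ord -card_ffun; exact: max_card.
have hN : (h + b <= a + N)%N.
  have -> : N = (b + #|[predC [pred f : {ffun 'I_m -> 'I_n} | injectiveb f]]|)%N.
    by rewrite /b -card_injectiveb cardC card_ffun !card_ord.
  rewrite addnCA addnC leq_add2l.
  rewrite -[h](cardID [pred f : {ffun 'I_m -> 'I_n} | injectiveb f]).
  apply: leq_add; apply: subset_leq_card; apply/fintype.subsetP => f; rewrite !inE.
    by rewrite hombE; case/andP=> -> ->.
  by case/andP.
have b0 : (0 < b)%N by rewrite ffact_gt0.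
have N0 : (0 < N)%N by exact: leq_trans bN.
clearbody a h b N.
have b0' : 0 < b%:R :> R by rewrite ltr0n.
have N0' : 0 < N%:R :> R by rewrite ltr0n.
have aN : a%:R / N%:R <= a%:R / b%:R :> R.
  by rewrite ler_wpM2l// lef_pV2 ?posrE// ler_nat.
have bN1 : b%:R / N%:R <= 1 :> R by rewrite ler_pdivrMr// mul1r ler_nat.
have ab1 : a%:R / b%:R <= 1 :> R by rewrite ler_pdivrMr// mul1r ler_nat.
have ahN : a%:R / N%:R <= h%:R / N%:R :> R by rewrite ler_pM2r ?invr_gt0// ler_nat.
have hbN : h%:R / N%:R + b%:R / N%:R <= a%:R / N%:R + 1 :> R.
  rewrite -[X in _ <= _ + X](divff (lt0r_neq0 N0')) -!mulrDl ler_pM2r ?invr_gt0//.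
  by rewrite -!natrD ler_nat.
have abN : a%:R / N%:R = a%:R / b%:R * (b%:R / N%:R) :> R.
  by rewrite mulrA divfK// gt_eqF.
rewrite ler_norml; apply/andP; split; first by lra.
have : (a%:R / b%:R) * (1 - b%:R / N%:R) <= 1 - b%:R / N%:R :> R.
  by rewrite ler_piMl// subr_ge0.
by rewrite mulrBr mulr1 -abN; lra.
Qed.

Lemma ffact_expn_prod m n : (m <= n)%N -> (0 < n)%N ->
  (n ^_ m)%:R / (n ^ m)%:R = \prod_(i < m) (1 - i%:R * n%:R^-1) :> R.
Proof.
move=> mn n0; have n0' : n%:R != 0 :> R by rewrite pnatr_eq0 -lt0n.
rewrite ffact_prod natr_prod natrX -[X in _ / n%:R ^+ X]card_ord -prodr_const.
rewrite -prodf_div; apply: eq_bigr => i _.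
rewrite natrB ?mulrBl ?divff//.
by rewrite (leq_trans _ mn)// ltnW.
Qed.

End finite_counting.

Section limits.
Variable R : realType.
Implicit Types x : graph_space R.

Lemma repr_unlabel n (F : sgraph n.+1) :
  isob (repr (unlabel F)) (existT _ n F).
Proof. apply/eqquotP; exact: (reprK (unlabel F)). Qed.

Lemma isob_hom_density (F F' : fgraph) n (G : sgraph n) : isob F F' ->
  hom_density R (tagged F) G = hom_density R (tagged F') G.
Proof.
case: F F' => [m F] [m' F'] /isoP[/= f [fbij fe]].
have e : m.+1 = m'.+1 by have := bij_eq_card fbij; rewrite !card_ord.
case: e => e; subst m'; rewrite /hom_density; congr (_%:R / _).
have [g fK gK] := fbij.
pose p (h : {ffun 'I_m.+1 -> 'I_n}) := [ffun i => h (g i)].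
rewrite -(@card_in_image _ _ p [pred h | homb F G h]); last first.
  move=> h h' _ _ /ffunP hh'; apply/ffunP => i.
  by have := hh' (f i); rewrite !ffunE fK.
apply: eq_card => h; apply/fintype.imageP/idP => [[h']|].
  rewrite !inE => /forallP Fh ->; apply/forallP => i; apply/forallP => j.
  rewrite !ffunE -{1}[i]gK -{1}[j]gK -fe; exact: (forallP (Fh _)).
rewrite inE => /forallP Fh; exists [ffun i => h (f i)]; last first.
  by apply/ffunP => i; rewrite !ffunE gK.
rewrite inE; apply/forallP => i; apply/forallP => j.
by rewrite !ffunE fe; exact: (forallP (Fh _)).
Qed.

Lemma t_unlabel n (F : sgraph n.+1) (G : ugraph) :
  t R (unlabel F) G = hom_density R F (ulabel G).
Proof. exact: isob_hom_density (repr_unlabel F). Qed.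

#[global] Instance graphs_near_filter x : Filter (graphs_near x).
Proof.
apply: filter_from_filter; first by exists setT; exact: filterT.
move=> A B xA xB; exists (A `&` B); first exact: filterI.
by move=> G [].
Qed.

Lemma graphs_near_proper x : Ubar R x -> ProperFilter (graphs_near x).
Proof.
move=> Ux; apply: filter_from_proper => V xV.
by have [_ [[G _ <-] VG]] := Ux V xV; exists G.
Qed.

Lemma cvg_embedding x : @embedding R @ graphs_near x --> x.
Proof. by move=> V xV; exists V. Qed.

Lemma cvg_t x (F : ugraph) : t R F @ graphs_near x --> x.1 F.
Proof.
have c (p : graph_space R) : (fun p : graph_space R => p.1 F) @ p --> p.1 F.
  have c1 : (fst : graph_space R -> _) @ p --> p.1 by exact: cvg_fst.
  exact: (cvg_comp _ _ c1 (@proj_continuous ugraph (fun=> R) F p.1)).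
exact: (cvg_comp _ _ (@cvg_embedding x) (c x)).
Qed.

Lemma cvg_uorder x : ((uorder G)%:R^-1 : R) @[G --> graphs_near x] --> x.2.
Proof.
have c : (snd : graph_space R -> R) @ x --> x.2 by exact: cvg_snd.
exact: (cvg_comp _ _ (@cvg_embedding x) c).
Qed.

Lemma graph_space_hausdorff : hausdorff_space (graph_space R).
Proof.
have h1 : hausdorff_space {ptws ugraph -> R}.
  apply: (@hausdorff_product ugraph (fun=> R)) => _; exact: Rhausdorff.
move=> [p1 q1] [p2 q2] pq; congr pair.
  apply: h1 => A B pA pB; have [] := pq (fst @^-1` A) (fst @^-1` B).
  - exact: (@cvg_fst _ _ (nbhs p1) (nbhs q1) _).
  - exact: (@cvg_fst _ _ (nbhs p2) (nbhs q2) _).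
  - by move=> [u v] [/= Au Bu]; exists u.
apply: Rhausdorff => A B pA pB; have [] := pq (snd @^-1` A) (snd @^-1` B).
- exact: (@cvg_snd _ _ (nbhs p1) (nbhs q1) _).
- exact: (@cvg_snd _ _ (nbhs p2) (nbhs q2) _).
- by move=> [u v] [/= Au Bu]; exists v.
Qed.

Lemma finite_uorder N : finite_set [set G | (uorder G <= N)%N].
Proof.
apply: (@sub_finite_set _ _ (\bigcup_(n in `I_N) range (@unlabel n))).
  move=> G /= GN; exists (tag (repr G)) => //.
  exists (ulabel G) => //.
  by rewrite /unlabel /ulabel; case: (repr G) (reprK G).
by apply: bigcup_finite => // n _; exact: finite_image.
Qed.

Lemma graph_limit_order x : graph_limits R x -> x.2 = 0.
Proof.
move=> [Ux nx]; have PF := graphs_near_proper Ux.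
apply: contrapT => /eqP x2.
have x2gt0 : 0 < x.2.
  rewrite lt_def x2/=; apply: (cvgr_to_ge (@cvg_uorder x)).
  by apply: nearW => G; rewrite invr_ge0 ler0n.
have : \forall G \near graphs_near x, x.2 / 2 < (uorder G)%:R^-1.
  by apply: (cvgr_gt _ (@cvg_uorder x)); rewrite ltr_pdivrMr// ltr_pMr// ltr1n.
move=> [V xV VG]; pose N := Num.bound (2 / x.2).
have VN G : V (embedding R G) -> (uorder G <= N)%N.
  move=> /VG /= h; rewrite -(ler_nat R).
  have /(archi_boundP) /ltW : 0 <= 2 / x.2 by rewrite divr_ge0// ltW.
  apply: le_trans; rewrite -[leRHS]invf_div -[leLHS]invrK.
  by rewrite lef_pV2 ?posrE ?divr_gt0// ?invr_gt0 ?ltr0n// ltW.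
have : closure (@embedding R @` [set G | (uorder G <= N)%N]) x.
  move=> B xB; have [_ [[G _ <-] [VG' BG]]] := Ux _ (filterI xV xB).
  by exists (embedding R G); split => //; exists G => //; exact: VN.
have /closure_id <- : closed (@embedding R @` [set G | (uorder G <= N)%N]).
  have acc := hausdorff_accessible graph_space_hausdorff.
  apply: (proj1 accessible_finite_set_closed acc).
  exact: finite_image (finite_uorder N).
by move=> [G _ Gx]; apply: nx; exists G.
Qed.

Lemma cvg_uorder0 x : graph_limits R x ->
  ((uorder G)%:R^-1 : R) @[G --> graphs_near x] --> (0 : R).
Proof. by move=> xl; rewrite -(graph_limit_order xl); exact: cvg_uorder. Qed.

Lemma uorder_large x m : graph_limits R x ->
  \forall G \near graphs_near x, (m <= uorder G)%N.
Proof.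
move=> xl; have PF := graphs_near_proper xl.1.
have : \forall G \near graphs_near x, (uorder G)%:R^-1 < m.+1%:R^-1 :> R.
  by apply: (cvgr_lt _ (cvg_uorder0 xl)); rewrite invr_gt0 ltr0n.
apply: filterS => G.
by rewrite ltf_pV2 ?posrE ?ltr0n// ltr_nat => /ltnW /ltnW.
Qed.

Lemma cvg_inj_density x n (F : sgraph n.+1) : graph_limits R x ->
  inj_density R F (ulabel G) @[G --> graphs_near x] --> x.1 (unlabel F).
Proof.
move=> xl; have PF := graphs_near_proper xl.1.
pose q (s : R) := 1 - \prod_(i < n.+1) (1 - i%:R * s).
have q0 : q ((uorder G)%:R^-1) @[G --> graphs_near x] --> (0 : R).
  rewrite [X in _ --> X](_ : _ = q 0); last first.
    by rewrite /q big1 ?subrr// => i _; rewrite mulr0 subr0.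
  apply: cvgB; first exact: cvg_cst.
  apply: cvg_big => [|i _]; first exact: mul_continuous.
  apply: cvgB; first exact: cvg_cst.
  by apply: cvgM; [exact: cvg_cst|exact: cvg_uorder0].
have d0 : inj_density R F (ulabel G) - t R (unlabel F) G
    @[G --> graphs_near x] --> (0 : R).
  apply/norm_cvg0P.
  apply: (@squeeze_cvgr _ _ _ _ (fun=> 0) (fun G => q (uorder G)%:R^-1)) => //;
    last exact: cvg_cst.
  near=> G; rewrite normr_ge0/= t_unlabel /q -ffact_expn_prod//.
    by apply: inj_density_hom; near: G; exact: uorder_large.
  by near: G; exact: uorder_large.
rewrite -[x.1 _]add0r (_ : (fun G => inj_density R F (ulabel G)) =
  (fun G => inj_density R F (ulabel G) - t R (unlabel F) G + t R (unlabel F) G)).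
  by apply: cvgD d0 _; exact: cvg_t.
by apply/funext => G; rewrite subrK.
Unshelve. all: by end_near. Qed.

Lemma is_cvg_t_ind x n (F : sgraph n.+1) : graph_limits R x ->
  cvg (t_ind R F @ graphs_near x).
Proof.
move=> xl; have PF := graphs_near_proper xl.1.
pose nonedges (H : sgraph n.+1) := #|[pred p : 'I_n.+1 * 'I_n.+1 | ~~ H p.1 p.2]|.
have [k] := ubnP (nonedges F); elim: k => // k IH in F *; rewrite ltnS => Fk.
have E : t_ind R F = fun G : ugraph => inj_density R F (ulabel G) -
    \sum_(H | subgraphb F H && (H != F)) t_ind R H G.
  apply/funext => G; rewrite /inj_density (bigD1 F)/= ?addrK//.
  by apply/forallP => i; apply/forallP => j; exact: implybb.
rewrite E; apply: is_cvgB; first by apply/cvg_ex; eexists; exact: cvg_inj_density.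
apply/cvg_ex; exists (\sum_(H | subgraphb F H && (H != F)) lim (t_ind R H @ graphs_near x)).
apply: cvg_big => [|H /andP[/forallP FH HF]]; first exact: add_continuous.
apply: IH; apply: leq_trans Fk; apply: proper_card; apply/properP; split.
  apply/fintype.subsetP => -[i j]; rewrite !inE/=; apply: contra.
  exact: (implyP (forallP (FH i) j)).
have [p] : exists p, H p.1 p.2 && ~~ F p.1 p.2.
  apply/existsP; apply: contraNT HF => /existsPn h; apply/eqP/sgraph_eqP => i j.
  have := h (i, j); have /implyP := forallP (FH i) j; rewrite /=.
  by case: (F i j); case: (H i j) => // -> .
by case/andP=> Hp Fp; exists p; rewrite !inE ?Hp.
Qed.

Lemma cvg_t_ind x n (F : sgraph n.+1) : graph_limits R x ->
  t_ind R F @ graphs_near x --> t_ind_ext F x.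
Proof. exact: is_cvg_t_ind. Qed.

Lemma t_ind_ext_ge0 x n (F : sgraph n.+1) : graph_limits R x ->
  0 <= t_ind_ext F x.
Proof.
move=> xl; have PF := graphs_near_proper xl.1.
apply: (cvgr_to_ge (@cvg_t_ind x n F xl)).
by apply: nearW => G; rewrite /t_ind /ind_density; case: ifP => // _; rewrite divr_ge0.
Qed.

Lemma t_ind_ext_total x n : graph_limits R x ->
  \sum_(F : sgraph n.+1) t_ind_ext F x = 1.
Proof.
move=> xl; have PF := graphs_near_proper xl.1.
have c1 : \sum_(F : sgraph n.+1) t_ind R F G @[G --> graphs_near x] -->
    \sum_(F : sgraph n.+1) t_ind_ext F x.
  apply: cvg_big => [|F _]; last exact: cvg_t_ind.
  exact: add_continuous.
apply: (cvg_unique (@Rhausdorff R) c1).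
apply: cvg_near_cst; near=> G; apply: ind_density_total.
by near: G; exact: uorder_large.
Unshelve. all: by end_near. Qed.

End limits.

Lemma empty_subproof n :
  let a := [ffun=> false] : {ffun 'I_n * 'I_n -> bool} in
  [forall x, forall y, a (x, y) == a (y, x)] && [forall x, ~~ a (x, x)].
Proof.
apply/andP; split; apply/forallP => x; last by rewrite ffunE.
by apply/forallP => y; rewrite !ffunE.
Qed.

HB.instance Definition _ n := isPointed.Build (sgraph n)
  (SGraph (empty_subproof n)).

HB.instance Definition _ n := @isMeasurable.Build default_measure_display
  (sgraph n) discrete_measurable discrete_measurable0
  discrete_measurableC discrete_measurableU.

(* The law of G(n.+1, Gamma), a probability measure on the labelled graphs with
   n.+1 vertices: the graph F has probability t_ind_ext F Gamma. *)
Definition random_graph (R : realType) (Gamma : graph_limits R) n :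
    set (sgraph n.+1) -> \bar R :=
  fun A => (\sum_(F \in A) (t_ind_ext F (val Gamma))%:E)%E.

Arguments random_graph {R} Gamma n.

Section random_graph_probability.
Local Open Scope ereal_scope.
Variables (R : realType) (Gamma : graph_limits R) (n : nat).
Local Notation law := (random_graph Gamma n).

Let law_term_ge0 (F : sgraph n.+1) : 0 <= (t_ind_ext F (val Gamma))%:E.
Proof. by rewrite lee_fin t_ind_ext_ge0//; exact: set_valP. Qed.

Let law0 : law set0 = 0. Proof. by rewrite /random_graph fsbig_set0. Qed.

Let law_ge0 A : 0 <= law A.
Proof. by rewrite /random_graph fsume_ge0. Qed.

Let law_sigma_additive : semi_sigma_additive law.
Proof.
move=> A mA tA mUA; rewrite /random_graph; apply: cvg_toP.
  apply: ereal_nondecreasing_is_cvgn => i j ij; apply: lee_sum_nneg_natr => // k _ _.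
  exact: law_ge0.
transitivity (\sum_(0 <= i <oo) \esum_(F in A i) (t_ind_ext F (val Gamma))%:E).
  apply: eq_eseriesr => k _; rewrite esum_fset => [//||F _]; last exact: law_term_ge0.
  exact: finite_finset.
rewrite -nneseries_sum_bigcup// esum_fset//; exact: finite_finset.
Qed.

HB.instance Definition _ := isMeasure.Build _ _ _ law
  law0 law_ge0 law_sigma_additive.

Let law_setT : law [set: _] = 1.
Proof.
rewrite /random_graph fsbig_finite//= sumEFin; congr EFin.
rewrite -(@t_ind_ext_total R (val Gamma) n); last exact: set_valP.
rewrite (perm_big (index_enum (sgraph n.+1)))//.
apply: uniq_perm; rewrite ?finmap.fset_uniq ?index_enum_uniq// => F.
by rewrite mem_index_enum in_fset_set ?in_setT//; exact: finite_finset.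
Qed.

HB.instance Definition _ :=
  @Measure_isProbability.Build _ _ R law law_setT.

End random_graph_probability.

(* Main.v *)
From Pilot Require Import Defs.
From mathcomp Require Import all_boot all_order all_algebra generic_quotient.
From mathcomp Require Import all_classical all_reals all_analysis.
From mathcomp Require Import ring lra.

Set Implicit Arguments.
Unset Strict Implicit.
Unset Printing Implicit Defensive.

Import Order.TTheory GRing.Theory Num.Theory.
Import numFieldNormedType.Exports.
(* The name induced is also a notation of the charge theory; this import gives
   it back its graph-theoretic meaning. *)
Import Pilot.Defs.

Local Open Scope classical_set_scope.
Local Open Scope ring_scope.

(** By [ae_random_graph], the almost sure statement says that t_ind(F, Gamma)
    vanishes for every labelled graph F outside P.

    If Gamma is in the closure of P and t_ind(F, Gamma) > 0, then by continuity
    t_ind(F, G) > 0 for all graphs G near Gamma, hence for some G in P; such a G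
    has an induced copy of F, so heredity puts F in P ([t_ind_ext_closure]).

    Conversely, the random graphs G(n, Gamma) converge to Gamma in probability.
    If they almost surely lie in P, then every neighbourhood of Gamma contains
    an element of P. Convergence in probability is phrased with one filter on
    the set of unlabelled graphs, [sampled]: a set A belongs to it when the
    probability that G(n, Gamma) is outside A tends to 0. It is a proper filter,
    it contains P, and the embedding converges to Gamma along it
    ([cvg_sampled]); this last point can be checked coordinate by coordinate.

    For the coordinate t(K, .) the argument is a second moment computation.
    Sampling k of n sampled vertices of G is the same as sampling k vertices of
    G ([sum_ind_density_induced]); letting G tend to Gamma, the restriction of
    G(n, Gamma) to any k given vertices contains K with probability exactly
    t(K, Gamma) ([mean_subgraph_induced]). Averaging over the k vertices, t(K, G(n, Gamma)) has mean t(K, Gamma), up to the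
    probability that a random map from k to n points is not injective. The
    square of t(K, .) is t(K + K, .), where + is the disjoint union
    ([hom_density_dunion]), and this identity persists for Gamma by continuity
    ([limit_dunion]). So the first moment estimate for K + K controls the second
    moment, the mean square error tends to 0 ([cvg_mean_square_error]), and
    Chebyshev's inequality gives convergence in probability
    ([cvg_sampled_t]). *)

(** * Restricting random injections *)

Lemma perm_of_injections (T U : finType) (h h' : T -> U) :
  injective h -> injective h' ->
  exists2 s : U -> U, injective s & forall x, s (h x) = h' x.
Proof.
(* List the image of an injection in the order of its arguments, then the other
   points of U; s sends the i-th entry of the list of h to that of h'. *)
pose l (f : T -> U) := codom f ++ enum [predC codom f].
have luniq f : injective f -> uniq (l f).
  move=> finj; rewrite cat_uniq map_inj_uniq// !enum_uniq andbT/=.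
  by apply/hasPn => u; rewrite mem_enum.
have lmem f u : u \in l f by rewrite mem_cat mem_enum orbN.
have lsize f : injective f -> size (l f) = #|U|.
  move=> finj; rewrite -(card_uniqP (luniq f finj)).
  by apply: eq_card => u; rewrite lmem.
move=> hinj h'inj; pose s u := nth u (l h') (index u (l h)).
have lt_s u : (index u (l h) < size (l h'))%N.
  by rewrite !lsize// -(lsize h)// index_mem.
have sinj : injective s.
  move=> u v; rewrite /s (set_nth_default v)// => /eqP.
  by rewrite nth_uniq ?luniq// => /eqP; apply: index_inj.
exists s => // x; rewrite /s /l.
rewrite index_cat codom_f /codom /image_mem index_map//.
rewrite nth_cat size_map index_mem mem_enum (nth_map x) ?index_mem ?mem_enum//.
by rewrite nth_index ?mem_enum.
Qed.

(** The restriction of a uniformly random injection 'I_n -> 'I_N along g is a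
    uniformly random injection 'I_k -> 'I_N: all its fibres have the same size,
    because post-composition with a permutation of 'I_N that carries h to h'
    carries the fibre over h into the one over h'. The equality of the two
    proportions is stated without denominators. *)
Lemma card_restrict k n N (g : 'I_k -> 'I_n) (Q : pred {ffun 'I_k -> 'I_N}) :
  injective g ->
  (#|[pred f : {ffun 'I_n -> 'I_N} | injectiveb f && Q [ffun i => f (g i)]]|
     * N ^_ k =
   #|[pred h : {ffun 'I_k -> 'I_N} | injectiveb h && Q h]| * N ^_ n)%N.
Proof.
move=> ginj.
pose c (h : {ffun 'I_k -> 'I_N}) :=
  #|[pred f : {ffun 'I_n -> 'I_N} |
      injectiveb f && ([ffun i => f (g i)] == h)]|.
have sumc (Q' : pred {ffun 'I_k -> 'I_N}) :
    #|[pred f : {ffun 'I_n -> 'I_N} | injectiveb f && Q' [ffun i => f (g i)]]| =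
    (\sum_(h : {ffun 'I_k -> 'I_N} | injectiveb h && Q' h) c h)%N.
  rewrite -sum1_card (partition_big
    (fun f : {ffun _ -> _} => [ffun i => f (g i)])
    (fun h : {ffun _ -> _} => injectiveb h && Q' h))/=; last first.
    move=> f; rewrite inE => /andP[/injectiveP finj ->]; rewrite andbT.
    by apply/injectiveP => i j; rewrite !ffunE => /finj/ginj.
  apply: eq_bigr => h /andP[_ Q'h]; rewrite /c -sum1_card; apply: eq_bigl => f.
  by rewrite !inE -andbA; case: eqP => [->|]; rewrite ?andbF// Q'h.
have cle (h h' : {ffun 'I_k -> 'I_N}) :
    injective h -> injective h' -> (c h <= c h')%N.
  move=> hinj h'inj; have [s sinj sh] := perm_of_injections hinj h'inj.
  pose p (f : {ffun 'I_n -> 'I_N}) := [ffun i => s (f i)].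
  have pinj : injective p.
    move=> f f' /ffunP ff'; apply/ffunP => i.
    by have := ff' i; rewrite !ffunE => /sinj.
  rewrite /c -(fintype.card_image pinj); apply: subset_leq_card.
  apply/fintype.subsetP => _ /fintype.imageP[f + ->].
  rewrite !inE => /andP[/injectiveP finj /eqP/ffunP fh]; apply/andP; split.
    by apply/injectiveP => i j; rewrite !ffunE => /sinj/finj.
  by apply/eqP/ffunP => i; rewrite -sh -fh !ffunE.
(* A fibre size c h0 serves as the common value; when there is no injection h0
   at all, both sides are 0. *)
have [h0 h0inj|none] := pickP [pred h : {ffun 'I_k -> 'I_N} | injectiveb h];
    last first.
  rewrite sumc big_pred0; last first.
    by move=> h; rewrite -[injectiveb h]/([pred h | _] h) none.
  by rewrite eq_card0// => h; rewrite inE -[injectiveb h]/([pred h | _] h) none.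
have sumc0 (Q' : pred {ffun 'I_k -> 'I_N}) :
    (\sum_(h : {ffun 'I_k -> 'I_N} | injectiveb h && Q' h) c h =
     #|[pred h : {ffun 'I_k -> 'I_N} | injectiveb h && Q' h]| * c h0)%N.
  rewrite -sum_nat_const; apply: eq_bigr => h /andP[/injectiveP hinj _].
  by apply/eqP; rewrite eqn_leq !cle//; apply/injectiveP.
rewrite sumc sumc0 -mulnA; congr (_ * _)%N.
have := sumc predT; rewrite sumc0.
have cardT m :
    #|[pred f : {ffun 'I_m -> 'I_N} | injectiveb f && true]| = (N ^_ m)%N.
  by rewrite -card_injectiveb; apply: eq_card => f; rewrite !inE andbT.
by rewrite !cardT mulnC => ->.
Qed.

(** * Finite graphs and their densities *)

Lemma induced_comp k m n (G : sgraph n) (f : 'I_m -> 'I_n) (g : 'I_k -> 'I_m) :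
  induced (induced G f) g = induced G (f \o g).
Proof. by apply: sgraph_eqP => x y; rewrite /edge/= !ffunE /edge/= ffunE. Qed.

Lemma eq_induced m n (G : sgraph n) (f g : 'I_m -> 'I_n) :
  f =1 g -> induced G f = induced G g.
Proof. by move=> fg; apply: sgraph_eqP => x y; rewrite /edge/= !ffunE/= !fg. Qed.

Lemma dunion_subproof k l (K : sgraph k) (L : sgraph l) :
  let a : {ffun 'I_(k + l) * 'I_(k + l) -> bool} := [ffun p =>
    match fintype.split p.1, fintype.split p.2 with
    | inl i, inl j => K i j
    | inr i, inr j => L i j
    | _, _ => false
    end] in
  [forall x, forall y, a (x, y) == a (y, x)] && [forall x, ~~ a (x, x)].
Proof.
have /andP[/forallP Ksym /forallP Kirr] := adjP K.
have /andP[/forallP Lsym /forallP Lirr] := adjP L.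
apply/andP; split; apply/forallP => x.
  apply/forallP => y; rewrite !ffunE/=.
  case: (fintype.split x) => i; case: (fintype.split y) => j //.
    exact: (forallP (Ksym i)).
  exact: (forallP (Lsym i)).
by rewrite ffunE/=; case: (fintype.split x) => i; [exact: Kirr|exact: Lirr].
Qed.

Definition dunion k l (K : sgraph k) (L : sgraph l) : sgraph (k + l) :=
  SGraph (dunion_subproof K L).

Section finite.
Variable R : realType.

(** Homomorphisms from the disjoint union are pairs of homomorphisms. *)
Lemma hom_density_dunion k l n (K : sgraph k) (L : sgraph l) (G : sgraph n) :
  hom_density R (dunion K L) G = hom_density R K G * hom_density R L G.
Proof.
rewrite /hom_density mulf_div -!natrM !card_ffun !card_ord -expnD.
congr (_%:R / _); rewrite -cardX.
pose glue (p : {ffun 'I_k -> 'I_n} * {ffun 'I_l -> 'I_n}) :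
    {ffun 'I_(k + l) -> 'I_n} :=
  [ffun i => match fintype.split i with inl j => p.1 j | inr j => p.2 j end].
have gluel p i : glue p (lshift l i) = p.1 i.
  by rewrite ffunE (unsplitK (inl i)).
have gluer p i : glue p (rshift k i) = p.2 i.
  by rewrite ffunE (unsplitK (inr i)).
have ginj : injective glue.
  move=> [f1 f2] [g1 g2] /ffunP fg; congr pair; apply/ffunP => i.
    by have := fg (lshift l i); rewrite !gluel.
  by have := fg (rshift k i); rewrite !gluer.
have glueE p : homb (dunion K L) G (glue p) = homb K G p.1 && homb L G p.2.
  apply/forallP/andP => [h|[/forallP hK /forallP hL] x].
    split; apply/forallP => i; apply/forallP => j.
      have := forallP (h (lshift l i)) (lshift l j); rewrite !gluel.
      by rewrite {1}/edge/= ffunE/= !(unsplitK (inl _)).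
    have := forallP (h (rshift k i)) (rshift k j); rewrite !gluer.
    by rewrite {1}/edge/= ffunE/= !(unsplitK (inr _)).
  apply/forallP => y; rewrite {1}/edge/= !ffunE/=.
  case: (fintype.split x) => i; case: (fintype.split y) => j //.
    exact: (forallP (hK i)).
  exact: (forallP (hL i)).
rewrite -(fintype.card_image ginj); apply: eq_card => f.
apply/idP/fintype.imageP => [|[p + ->]]; last by rewrite !inE glueE.
have -> : f = glue ([ffun i => f (lshift l i)], [ffun i => f (rshift k i)]).
  by apply/ffunP => i; case: (split_ordP i) => j ->; rewrite ?gluel ?gluer ffunE.
by rewrite inE glueE => h; eexists; last reflexivity; rewrite inE.
Qed.

Lemma hom_density_isob_r m (F : sgraph m) (G G' : fgraph) : isob G G' ->
  hom_density R F (tagged G) = hom_density R F (tagged G').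
Proof.
case: G G' => [n G] [n' G'] /isoP[/= f [fbij fe]].
have e : n.+1 = n'.+1 by have := bij_eq_card fbij; rewrite !card_ord.
case: e => e; subst n'; rewrite /hom_density; congr (_%:R / _).
have [g fK gK] := fbij.
pose p (h : {ffun 'I_m -> 'I_n.+1}) := [ffun i => f (h i)].
have pinj : injective p.
  move=> h h' /ffunP hh'; apply/ffunP => i.
  by have := hh' i; rewrite !ffunE => /(can_inj fK).
have pE h : homb F G' (p h) = homb F G h.
  by apply: eq_forallb => x; apply: eq_forallb => y; rewrite !ffunE fe.
rewrite -(fintype.card_image pinj); apply: eq_card => h.
apply/fintype.imageP/idP => [[h' + ->]|]; first by rewrite !inE pE.
have -> : h = p [ffun i => g (h i)] by apply/ffunP => i; rewrite !ffunE gK.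
by rewrite inE pE => hh; eexists; last reflexivity; rewrite inE.
Qed.

Lemma t_unlabel_r (K : ugraph) n (F : sgraph n.+1) :
  t R K (unlabel F) = hom_density R (ulabel K) F.
Proof. exact: (hom_density_isob_r _ (repr_unlabel F)). Qed.

Lemma uorder_unlabel n (F : sgraph n.+1) : uorder (unlabel F) = n.+1.
Proof.
have /isoP[f [fbij _]] := repr_unlabel F.
by have := bij_eq_card fbij; rewrite !card_ord.
Qed.

Lemma unlabel_ulabel (G : ugraph) : unlabel (ulabel G) = G.
Proof. by rewrite /unlabel /ulabel; case: (repr G) (reprK G). Qed.

(** Sampling n vertices of G and keeping the k ones labelled by g amounts to
    sampling k vertices of G, by [card_restrict]. *)
Lemma sum_ind_density_induced k n N (G : sgraph N) (g : 'I_k -> 'I_n)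
    (Q : pred (sgraph k)) : injective g -> (n <= N)%N ->
  \sum_(F : sgraph n | Q (induced F g)) ind_density R F G =
  \sum_(F | Q F) ind_density R F G.
Proof.
move=> ginj nN.
have kn : (k <= n)%N by have := leq_card g ginj; rewrite !card_ord.
have kN := leq_trans kn nN.
rewrite !sum_ind_density//.
have n0 : (N ^_ n)%:R != 0 :> R by rewrite pnatr_eq0 -lt0n ffact_gt0.
have k0 : (N ^_ k)%:R != 0 :> R by rewrite pnatr_eq0 -lt0n ffact_gt0.
apply/eqP; rewrite eqr_div// -!natrM; apply/eqP; congr _%:R.
rewrite -(card_restrict (fun h : {ffun 'I_k -> 'I_N} => Q (induced G h)) ginj).
congr (_ * _)%N; apply: eq_card => f; rewrite !inE induced_comp.
by congr (_ && Q _); apply: eq_induced => i; rewrite ffunE.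
Qed.

End finite.

(** * First and second moments of densities of the random graph *)

Section moments.
Variables (R : realType) (x : graph_space R).
Hypothesis xl : graph_limits R x.

(** The expectation of X under the law of G(n.+1, x). *)
Definition mean n (X : sgraph n.+1 -> R) : R := \sum_F t_ind_ext F x * X F.

Lemma meanD n (X Y : sgraph n.+1 -> R) :
  mean (fun F => X F + Y F) = mean X + mean Y.
Proof. by rewrite /mean -big_split; apply: eq_bigr => F _; rewrite mulrDr. Qed.

Lemma meanZ n c (X : sgraph n.+1 -> R) :
  mean (fun F => c * X F) = c * mean X.
Proof. by rewrite /mean mulr_sumr; apply: eq_bigr => F _; rewrite mulrCA. Qed.

Lemma mean_cst n c : mean (fun _ : sgraph n.+1 => c) = c.
Proof. by rewrite /mean -mulr_suml t_ind_ext_total// mul1r. Qed.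

Lemma le_mean n (X Y : sgraph n.+1 -> R) :
  (forall F, X F <= Y F) -> mean X <= mean Y.
Proof.
by move=> XY; apply: ler_sum => F _; rewrite ler_wpM2l// t_ind_ext_ge0.
Qed.

(** Both sides are limits of the same quantity as G tends to x: for a large
    finite graph G, the left side becomes the probability that a random injection
    of the vertices of K into G preserves edges. *)
Lemma mean_subgraph_induced k n (K : sgraph k.+1) (g : 'I_k.+1 -> 'I_n.+1) :
  injective g ->
  mean (fun F => (subgraphb K (induced F g))%:R) = x.1 (unlabel K).
Proof.
move=> ginj; have PF := graphs_near_proper xl.1.
have -> : mean (fun F => (subgraphb K (induced F g))%:R) =
    \sum_(F | subgraphb K (induced F g)) t_ind_ext F x.
  rewrite [RHS]big_mkcond; apply: eq_bigr => F _.
  by case: subgraphb; rewrite ?mulr1 ?mulr0.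
have c : \sum_(F | subgraphb K (induced F g)) t_ind R F G @[G --> graphs_near x]
    --> \sum_(F | subgraphb K (induced F g)) t_ind_ext F x.
  by apply: cvg_big => [|F _]; [exact: add_continuous|exact: cvg_t_ind].
apply: (cvg_unique (@Rhausdorff R) c) => /=.
apply: (cvg_trans _ (cvg_inj_density (F := K) xl)); apply: near_eq_cvg; near=> G.
apply/esym; apply: sum_ind_density_induced => //; near: G; exact: uorder_large.
Unshelve. all: by end_near. Qed.

Lemma mean_inj_density k n (K : sgraph k.+1) : (k <= n)%N ->
  mean (fun F : sgraph n.+1 => inj_density R K F) = x.1 (unlabel K).
Proof.
move=> kn.
transitivity (mean (fun F : sgraph n.+1 => (n.+1 ^_ k.+1)%:R^-1 *
    \sum_(g : {ffun 'I_k.+1 -> 'I_n.+1} | injectiveb g)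
      (subgraphb K (induced F g))%:R)).
  apply: eq_bigr => F _; congr (_ * _).
  rewrite /inj_density sum_ind_density// mulrC; congr (_ * _).
  rewrite -natr_sum; congr _%:R; rewrite -sum1_card big_mkcondr/=.
  by apply: eq_bigr => g _; case: subgraphb.
rewrite meanZ.
have -> : mean (fun F : sgraph n.+1 =>
      \sum_(g : {ffun 'I_k.+1 -> 'I_n.+1} | injectiveb g)
        (subgraphb K (induced F g))%:R) =
    \sum_(g : {ffun 'I_k.+1 -> 'I_n.+1} | injectiveb g) x.1 (unlabel K).
  rewrite /mean; under eq_bigr do rewrite mulr_sumr.
  rewrite exchange_big; apply: eq_bigr => g /injectiveP ginj.
  exact: mean_subgraph_induced.
rewrite sumr_const card_injectiveb -[x.1 _ *+ _]mulr_natl mulKf//.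
by rewrite pnatr_eq0 -lt0n ffact_gt0.
Qed.

(** The probability that a uniformly random map from k to n points is not
    injective. *)
Definition collision k n : R := 1 - (n ^_ k)%:R / (n ^ k)%:R.

Lemma cvg_collision k : collision k n.+1 @[n --> \oo] --> (0 : R).
Proof.
pose q (s : R) := 1 - \prod_(i < k) (1 - i%:R * s).
have c : q (n.+1%:R^-1) @[n --> \oo] --> (0 : R).
  rewrite [X in _ --> X](_ : _ = q 0); last first.
    by rewrite /q big1 ?subrr// => i _; rewrite mulr0 subr0.
  apply: cvgB; first exact: cvg_cst.
  apply: cvg_big => [|i _]; first exact: mul_continuous.
  apply: cvgB; first exact: cvg_cst.
  by apply: cvgM; [exact: cvg_cst|exact: cvg_harmonic].
apply: (cvg_trans _ c); apply: near_eq_cvg; near=> n.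
rewrite /q /collision ffact_expn_prod//.
by near: n; exists k => // n /= kn; exact: leqW.
Unshelve. all: by end_near. Qed.

Lemma mean_hom_density k n (K : sgraph k.+1) : (k <= n)%N ->
  `|mean (fun F : sgraph n.+1 => hom_density R K F) - x.1 (unlabel K)|
    <= collision k.+1 n.+1.
Proof.
move=> kn; have h F := @inj_density_hom R k.+1 n.+1 K F kn.
rewrite -(mean_inj_density K kn) ler_norml; apply/andP; split.
  rewrite lerBrDl -[X in _ + X](mean_cst n) -meanD; apply: le_mean => F.
  by have := h F; rewrite ler_norml /collision => /andP[]; lra.
rewrite lerBlDl -[X in _ + X](mean_cst n) -meanD; apply: le_mean => F.
by have := h F; rewrite ler_norml /collision => /andP[]; lra.
Qed.

(** Multiplicativity passes from graphs to their limits. The index k + l.+1 is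
    k.+1 + l.+1 with its successor exposed, as [unlabel] demands. *)
Lemma limit_dunion k l (K : sgraph k.+1) (L : sgraph l.+1) :
  x.1 (@unlabel (k + l.+1) (dunion K L)) = x.1 (unlabel K) * x.1 (unlabel L).
Proof.
have PF := graphs_near_proper xl.1.
have /(_ _) c := cvgM (@cvg_t R x (unlabel K)) (@cvg_t R x (unlabel L)).
apply/esym; apply: (cvg_unique (@Rhausdorff R) c) => /=.
apply: (cvg_trans _ (@cvg_t R x (@unlabel (k + l.+1) (dunion K L)))).
apply: near_eq_cvg; apply: nearW => G.
by rewrite /= !t_unlabel; exact: (@hom_density_dunion R k.+1 l.+1 _ K L).
Qed.

Definition mean_square_error k (K : sgraph k.+1) n : R :=
  mean (fun F : sgraph n.+1 => (hom_density R K F - x.1 (unlabel K)) ^+ 2).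

(** With a = t(K, x), expand (t(K, .) - a)^2 as t(K + K, .) - 2 a t(K, .) + a^2.
    The means of the two densities are within collision probabilities of a^2 and
    a, and the main terms cancel. *)
Lemma cvg_mean_square_error k (K : sgraph k.+1) :
  mean_square_error K n @[n --> \oo] --> (0 : R).
Proof.
pose a := x.1 (unlabel K).
apply: (@squeeze_cvgr _ _ _ _ (fun=> 0) (fun n =>
  collision (k.+1 + k.+1) n.+1 + 2 * `|a| * collision k.+1 n.+1)); last 2 first.
- exact: cvg_cst.
- rewrite -[X in _ --> X](_ : 0 + 2 * `|a| * 0 = 0); last by rewrite mulr0 addr0.
  apply: cvgD; first exact: cvg_collision.
  by apply: cvgM; [exact: cvg_cst|exact: cvg_collision].
near=> n; apply/andP; split.
  by apply: sumr_ge0 => F _; rewrite mulr_ge0 ?sqr_ge0// t_ind_ext_ge0.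
have kn : (k + k.+1 <= n)%N by near: n; exists (k + k.+1)%N.
have h1 := mean_hom_density K (leq_trans (leq_addr _ _) kn).
have h2 := @mean_hom_density _ n (dunion K K) kn.
rewrite limit_dunion -/a in h2; rewrite -/a in h1.
set m2 := mean _ in h2; set m1 := mean _ in h1.
have -> : mean_square_error K n = m2 + (- (2 * a) * m1 + a ^+ 2).
  rewrite -meanZ -[X in _ + (_ + X)](mean_cst n) -!meanD.
  apply: eq_bigr => F _; congr (_ * _).
  by rewrite (@hom_density_dunion R k.+1 k.+1) -/a; ring.
have -> : m2 + (- (2 * a) * m1 + a ^+ 2) = (m2 - a * a) + 2 * a * (a - m1) by ring.
apply: lerD; first exact: le_trans (ler_norm _) h2.
apply: le_trans (ler_norm _) _; rewrite !normrM ger0_norm// distrC.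
by rewrite ler_wpM2l// mulr_ge0.
Unshelve. all: by end_near. Qed.

End moments.

(** * Convergence in probability of the random graphs *)

Section sampled.
Variables (R : realType) (x : graph_space R).
Hypothesis xl : graph_limits R x.

(** The probability that G(n.+1, x) is outside A. *)
Definition escape (A : set ugraph) n : R :=
  \sum_(F : sgraph n.+1 | `[< ~ A (unlabel F) >]) t_ind_ext F x.

(** Events of asymptotic probability 1: convergence along this filter is
    convergence in probability of the random graphs. *)
Definition sampled : set_system ugraph :=
  [set A | escape A n @[n --> \oo] --> (0 : R)].

Lemma escape_ge0 A n : 0 <= escape A n.
Proof. by apply: sumr_ge0 => F _; exact: t_ind_ext_ge0. Qed.

Lemma escape_eq0 (A : set ugraph) n :
  (forall F : sgraph n.+1, ~ A (unlabel F) -> t_ind_ext F x = 0) ->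
  escape A n = 0.
Proof. by move=> A0; apply: big1 => F /asboolP; exact: A0. Qed.

Lemma sampled_squeeze (A : set ugraph) (u : nat -> R) :
  (forall n, escape A n <= u n) -> u n @[n --> \oo] --> (0 : R) -> sampled A.
Proof.
move=> Au u0; apply: (@squeeze_cvgr _ _ _ _ (fun=> 0) u) => //.
  by apply: nearW => n; rewrite escape_ge0 Au.
exact: cvg_cst.
Qed.

(** Closure under intersection is the union bound; properness holds because the
    escape probability from the empty set is 1. *)
Lemma sampled_proper : ProperFilter sampled.
Proof.
have filt : Filter sampled.
  split.
  - apply: (@sampled_squeeze _ (fun=> 0)); last exact: cvg_cst.
    by move=> n; rewrite escape_eq0// => F /(_ I).
  - move=> A B A0 B0; apply: (@sampled_squeeze _ (fun n => escape A n + escape B n)).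
      move=> n; rewrite /escape big_mkcond [X in X + _]big_mkcond.
      rewrite [X in _ + X]big_mkcond/= -big_split; apply: ler_sum => F _ /=.
      have w0 := t_ind_ext_ge0 F xl.
      case: (asboolP (~ (A `&` B) (unlabel F))) => [abs|_];
        case: (asboolP (~ A (unlabel F))) => [_|/contrapT AF];
        case: (asboolP (~ B (unlabel F))) => [_|/contrapT BF];
        rewrite ?addr0 ?add0r ?lerDl ?addr_ge0//.
      by case: abs.
    by rewrite -[X in _ --> X]addr0; exact: cvgD.
  - move=> A B AB A0; apply: (@sampled_squeeze _ (escape A)) => // n.
    rewrite /escape big_mkcond [leRHS]big_mkcond; apply: ler_sum => F _ /=.
    have w0 := t_ind_ext_ge0 F xl.
    case: ifPn => [/asboolP nB|_]; last by case: ifP.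
    by rewrite ifT//; apply/asboolP => /AB.
apply: Build_ProperFilter_ex => A A0.
apply: contrapT => /forallNP nA.
have one : escape A = fun=> 1.
  apply/funext => n; rewrite /escape -(@t_ind_ext_total R x n xl).
  by apply: eq_bigl => F; apply/asboolP; exact: nA.
move: A0; rewrite /sampled/= one => A0.
have e : (0 : R) = 1 by apply: (cvg_unique (@Rhausdorff R) A0); exact: cvg_cst.
by have := oner_neq0 R; rewrite -e eqxx.
Qed.

#[local] Existing Instance sampled_proper.

(** Chebyshev's inequality: the indicator of a deviation by at least e is at most
    e^-2 times the squared deviation. *)
Lemma cvg_sampled_t (K : ugraph) : t R K @ sampled --> x.1 K.
Proof.
apply/cvgrPdist_lt => e e0.
pose L := ulabel K.
have LK : unlabel L = K by exact: unlabel_ulabel.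
apply: (@sampled_squeeze _ (fun n => e ^- 2 * mean_square_error x L n)); last first.
  rewrite -[X in _ --> X](mulr0 (e ^- 2)).
  by apply: cvgM; [exact: cvg_cst|exact: cvg_mean_square_error].
move=> n; rewrite /escape /mean_square_error /mean mulr_sumr big_mkcond.
apply: ler_sum => F _; have w0 := t_ind_ext_ge0 F xl.
have s0 : 0 <= (hom_density R L F - x.1 (unlabel L)) ^+ 2 by exact: sqr_ge0.
case: ifPn => [/asboolP/negP|_]; last first.
  by apply: mulr_ge0; [rewrite invr_ge0 sqr_ge0|exact: mulr_ge0].
rewrite -leNgt t_unlabel_r LK -/L => far.
rewrite mulrCA ler_peMr// ler_pdivlMl ?exprn_gt0// mulr1.
by rewrite -[leRHS]real_normK ?num_real// lerXn2r ?nnegrE ?(ltW e0)// distrC.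
Qed.

(** G(n.+1, x) has n.+1 vertices, so its escape probability from any
    neighbourhood of infinity is eventually 0. *)
Lemma cvg_sampled_uorder :
  ((uorder G)%:R^-1 : R) @[G --> sampled] --> (0 : R).
Proof.
apply/cvgrPdist_lt => e e0.
apply: cvg_near_cst.
have : \forall n \near \oo, n.+1%:R^-1 < e :> R.
  by apply: (cvgr_lt (0 : R)) => //; exact: cvg_harmonic.
apply: filterS => n ne; apply: escape_eq0 => F.
by rewrite sub0r normrN ger0_norm ?invr_ge0// uorder_unlabel.
Qed.

(** The topology on [graph_space] is the one of a product, so convergence of every
    density and of the inverse order is enough. *)
Lemma cvg_sampled : @embedding R @ sampled --> x.
Proof.
have c1 : (fun G => (t R)^~ G : {ptws ugraph -> R}) @ sampled --> x.1.
  apply: (proj2 (@cvg_sup _ _ _ _ _ _)) => K U [_ [[V oV <-] VK]] VU.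
  have /(@cvg_sampled_t K) tV : nbhs (x.1 K) V by apply: open_nbhs_nbhs.
  by apply: (@filterS _ sampled _ _ _ _ tV) => G; exact: VU.
have c2 := cvg_sampled_uorder; rewrite -(graph_limit_order xl) in c2.
exact: (cvg_pair c1 c2).
Qed.

Lemma closure_of_sampled (P : graph_class) : sampled P -> closure_of P x.
Proof.
move=> P0 V xV; have [G [PG VG]] := filter_ex (filterI P0 (cvg_sampled xV)).
by exists (embedding R G); split => //; exists G.
Qed.

(** A positive induced density at x is positive on a neighbourhood of x, which
    meets P in a graph having F as an induced subgraph. *)
Lemma t_ind_ext_closure (P : graph_class) : hereditary P -> closure_of P x ->
  forall n (F : sgraph n.+1), ~ P (unlabel F) -> t_ind_ext F x = 0.
Proof.
move=> hP xP n F nPF; have PF := graphs_near_proper xl.1.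
apply/eqP; rewrite eq_le t_ind_ext_ge0// andbT leNgt; apply/negP => w0.
have [V xV VG] := cvgr_gt _ (@cvg_t_ind R x n F xl) _ w0.
have [_ [[G PG <-] VxG]] := xP V xV.
have := VG G VxG; rewrite /= /t_ind /ind_density; case: ifP => _; last by rewrite ltxx.
have [f|none] := pickP [pred f | embb F (ulabel G) f]; last first.
  by rewrite eq_card0// mul0r ltxx.
rewrite inE embbE => /andP[/injectiveP finj /eqP Ff] _; apply: nPF; rewrite Ff.
by apply: hP => //; rewrite -/(ulabel G) unlabel_ulabel.
Qed.

End sampled.

(** * Almost sure membership *)

Lemma ae_random_graph (R : realType) (Gamma : graph_limits R) n
    (Q : set (sgraph n.+1)) :
  {ae random_graph Gamma n, forall F, Q F} <->
  forall F, ~ Q F -> t_ind_ext F (val Gamma) = 0.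
Proof.
have w0 (F : sgraph n.+1) : (0 <= (t_ind_ext F (val Gamma))%:E)%E.
  by rewrite lee_fin t_ind_ext_ge0//; exact: set_valP.
have mQ : measurable (~` Q) by [].
split=> [/(negligibleP _ mQ) Q0 F nQF|Q0].
  by apply: EFin_inj; apply: (pfsume_eq0 _ _ Q0) => //; exact: finite_finset.
apply/(negligibleP _ mQ); rewrite /= /random_graph fsbig1// => F nQF.
by rewrite Q0.
Qed.

Theorem theorem3p1 (R : realType) (P : graph_class) (Gamma : graph_limits R) :
  hereditary P ->
  (closure_of P (val Gamma) <->
   forall n : nat, {ae random_graph Gamma n, forall F, P (unlabel F)}).
Proof.
move=> hP; have xl : graph_limits R (val Gamma) by exact: set_valP.
split=> [xP n|aeP]; first by apply/ae_random_graph; exact: t_ind_ext_closure.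
apply: closure_of_sampled => //; apply: cvg_near_cst; apply: nearW => n.
by apply: escape_eq0; exact/ae_random_graph.
Qed.
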